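(* Let $\mu_A,\mu_B$ be probability distributions over the vertices of the $d$-dimensional discrete hypercube ($d\ge1$). There exists an optimal transportation $\tau$ from $\mu_A$ to $\mu_B$ that, when combined with distance interpolation, produces a probability distribution $\mu_C$ over the midpoints $\widetilde{m}(\mu_A,\mu_B)$ such that $$S(\mu_C)\ge\frac13S(\mu_A)+\frac13S(\mu_B)+\frac{2}{5d^3}\big(W^2(\mu_A,\mu_B)\big)^2-\frac23.$$
   Context: The hypercube has vertex set $\{0,1\}^d$, edges between points at Hamming distance $1$, and graph distance $d(\cdot,\cdot)$ equal to Hamming distance. A transportation from $\mu_A$ to $\mu_B$ is a nonnegative function $\tau$ on pairs of vertices with $\mu_A(\alpha)=\sum_\beta\tau(\alpha,\beta)$ and $\mu_B(\beta)=\sum_\alpha\tau(\alpha,\beta)$. Put $W^2(\tau)=\sum_{\alpha,\beta}\tau(\alpha,\beta)d(\alpha,\beta)^2$ (here $2$ is an index, the order of the cost) and $W^2(\mu_A,\mu_B)=\min_\tau W^2(\tau)$; $\tau$ is optimal if it attains this minimum. Midpoints: if $d(a,b)$ is even, $\widetilde{m}(a,b)=\{u\in V: 2d(u,a)=2d(u,b)=d(a,b)\}$; if $d(a,b)$ is odd, $\widetilde{m}(a,b)$ is the set of edges $(u,v)\in E$ with $2d(u,a)+1=2d(v,b)+1=d(a,b)$. So midpoints are elements of $V\cup E$. Distance interpolation for $\tau$: for each pair $(a,b)$ the mass $\tau(a,b)$ is distributed uniformly over the geodesics from $a$ to $b$, and each geodesic's mass is placed at its midpoint (its middle vertex if its length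 is even, its middle edge if its length is odd). In the hypercube this spreads $\tau(a,b)$ uniformly over $\widetilde{m}(a,b)$. The resulting distribution on $V\cup E$ is $\mu_C$, i.e. $\mu_C(m)=\sum_{(a,b):\,m\in\widetilde{m}(a,b)}\tau(a,b)/|\widetilde{m}(a,b)|$. Entropy: $S(\mu)=\sum_y\mu(y)\ln(1/\mu(y))$. *)

(* Defs.v *)
From mathcomp Require Import all_boot all_order all_algebra.
From mathcomp Require Import classical_sets reals exp.

Set Implicit Arguments.
Unset Strict Implicit.
Unset Printing Implicit Defensive.

Import Order.TTheory GRing.Theory Num.Theory.
Local Open Scope ring_scope.

Section Hypercube.
Variable d : nat.

Definition vertex := {ffun 'I_d -> bool}.

Definition hdist (u v : vertex) : nat := #|[pred i | u i != v i]|.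

(* Edges are undirected: an edge is the two-element set of its endpoints. *)
Definition is_edge (e : {set vertex}) : bool :=
  [exists u, exists v, (hdist u v == 1%N) && (e == [set u; v])].

Definition edge := {e : {set vertex} | is_edge e}.

Definition vertex_or_edge := (vertex + edge)%type.

(* In the odd case an undirected edge qualifies when one of its two
   orientations (u, v) satisfies the distance conditions. *)
Definition midpoints (a b : vertex) : {set vertex_or_edge} :=
  [set m | match m with
           | inl u => [&& ~~ odd (hdist a b),
                          (2 * hdist u a == hdist a b)%N
                        & (2 * hdist u b == hdist a b)%N]
           | inr e => odd (hdist a b) &&
               [exists u, exists v,
                  [&& val e == [set u; v],
                      (2 * hdist u a + 1 == hdist a b)%N
                    & (2 * hdist v b + 1 == hdist a b)%N]]
           end].

End Hypercube.

Section Transport.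
Variable R : realType.

Definition is_distr (T : finType) (mu : T -> R) : Prop :=
  (forall x, 0 <= mu x) /\ \sum_x mu x = 1.

Definition entropy (T : finType) (mu : T -> R) : R :=
  \sum_y mu y * ln (1 / mu y).

Variable d : nat.
Implicit Types (muA muB : vertex d -> R) (tau : vertex d -> vertex d -> R).

Definition is_transport muA muB tau : Prop :=
  [/\ forall a b, 0 <= tau a b,
      forall a, muA a = \sum_b tau a b
    & forall b, muB b = \sum_a tau a b].

(* The 2 in the names is the order of the cost: no square root is taken, and
   [W2] is itself squared again in the entropy inequality. *)
Definition W2_cost tau : R := \sum_a \sum_b tau a b * (hdist a b)%:R ^+ 2.

Definition W2 muA muB : R :=
  inf [set c | exists2 tau, is_transport muA muB tau & c = W2_cost tau]%classic.

(* An optimal transportation attains the infimum, which is thus a minimum. *)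
Definition is_optimal muA muB tau : Prop :=
  is_transport muA muB tau /\ W2_cost tau = W2 muA muB.

Definition distr_midpoints muA muB : {set vertex_or_edge d} :=
  [set m | [exists a, exists b,
     [&& muA a != 0, muB b != 0 & m \in midpoints a b]]].

Definition interpolation tau (m : vertex_or_edge d) : R :=
  \sum_a \sum_(b | m \in midpoints a b) tau a b / #|midpoints a b|%:R.

End Transport.

(* Main.v *)
Require Import Defs.
From mathcomp Require Import all_boot all_order all_algebra.
From mathcomp Require Import classical_sets reals exp.
From mathcomp Require Import boolp topology normedtype sequences derive.
From mathcomp Require Import zify ring lra.

Set Implicit Arguments.
Unset Strict Implicit.
Unset Printing Implicit Defensive.

Import Order.TTheory GRing.Theory Num.Theory.
Import numFieldNormedType.Exports.
Local Open Scope ring_scope.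

(* Among the optimal plans take one, [tau], of maximal entropy.  Draw [(a, b)]
   from [tau] and then [m] uniformly among the midpoints of [(a, b)]; call the
   three marginals A, B, C.

   If two pairs [(a, b)], [(a', b')] in the support of [tau] share a midpoint
   [m], optimality for the squared distance forces all of [a, a'] to be at the
   same distance from all of [b, b'], with [m] a midpoint of each of the four
   pairs.  Exchanging mass between the pairs then leaves the cost unchanged, so
   maximality of the entropy gives
   [tau a b * tau a' b' = tau a b' * tau a' b]: A and B are independent given C.
   Moreover the coordinates in which the possible [a] differ from [m] are
   disjoint from those in which the possible [b] do, so [m] and its opposite
   midpoint [m' = a + b - m] determine [(a, b)].  As [m'] has the same law as
   [m], S(A | C) + S(B | C) = S(A, B | C) <= S(m' | m) <= S(C).

   With N the number of midpoints of [(a, b)], S(C | A) and S(C | B) are at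
   least E ln N, that is, S(C) >= S(A) - S(A | C) + E ln N and likewise for B.  Adding
   the three inequalities, 3 S(C) >= S(A) + S(B) + 2 E ln N.  Finally
   ln N >= 3 d(a, b) / 5 - 1, while d(a, b)^2 <= d * d(a, b) yields
   (W^2)^2 <= d^3 E d(a, b). *)

(** * Entropy and transport cost: first facts *)

Lemma mul_ln_inv (R : realType) (x : R) : x * ln (1 / x) = - (x * ln x).
Proof.
have [x0|x0] := ltP 0 x; first by rewrite div1r lnV ?posrE// mulrN.
(* For [x <= 0] both logarithms take the default value 0. *)
by rewrite !ln0 ?mulr0 ?oppr0// div1r invr_le0.
Qed.

Lemma entropyE (R : realType) (T : finType) (mu : T -> R) :
  entropy mu = \sum_x mu x * - ln (mu x).
Proof. by apply: eq_bigr => x _; rewrite mul_ln_inv mulrN. Qed.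

Lemma eq_entropy (R : realType) (T : finType) (mu nu : T -> R) :
  mu =1 nu -> entropy mu = entropy nu.
Proof. by move=> E; apply: eq_bigr => x _; rewrite E. Qed.

Lemma W2_le_cost (R : realType) (d : nat) (muA muB : vertex d -> R) tau :
  is_transport muA muB tau -> W2 muA muB <= W2_cost tau.
Proof.
move=> tT; apply: ge_inf; last by exists tau.
exists 0 => _ [tau' [tau'0 _ _] ->]; apply: sumr_ge0 => a _;
  apply: sumr_ge0 => b _.
by rewrite mulr_ge0// sqr_ge0.
Qed.

(** * Existence of an optimal plan of maximal entropy *)

(** Only the right-hand limit at 0 is delicate: with [s = sqrt y], the bound [- ln s < 1 / s] gives
    [|y * ln y| = 2 * s ^ 2 * (- ln s) < 2 * s]. *)
Lemma continuous_mul_ln (R : realType) : continuous (fun x : R => x * ln x).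
Proof.
move=> x; have [x0|x0|->] := ltgtP x 0.
- apply: cvg_near_cst; near=> y.
  have y0 : y < 0 by near: y; exact: lt_nbhsl.
  by rewrite !ln0 ?mulr0 ?(ltW x0) ?(ltW y0).
- by apply: cvgM; [exact: cvg_id|exact: continuous_ln].
rewrite /continuous_at mul0r; apply/cvgrPdist_lt => e e0; near=> y.
rewrite sub0r normrN.
have [y0|y0] := leP y 0; first by rewrite ln0// mulr0 normr0.
have [y1 ye] : y < 1 /\ y < (e / 2) ^+ 2.
  by split; near: y; apply: lt_nbhsl; rewrite ?exprn_gt0 ?divr_gt0.
have z0 : 0 < Num.sqrt y by rewrite sqrtr_gt0.
have lz : - ln (Num.sqrt y) < (Num.sqrt y)^-1.
  by rewrite -lnV ?posrE// ln_sublinear// invr_gt0.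
have ze : Num.sqrt y < e / 2.
  by rewrite -(@ltr_pXn2r _ 2) ?nnegrE ?sqr_sqrtr ?(ltW y0) ?sqrtr_ge0 ?ltW ?divr_gt0.
have l0 : ln y < 0 by apply: ln_lt0; rewrite y0.
rewrite normrM (gtr0_norm y0) (ltr0_norm l0) -[y in y * _]sqr_sqrtr ?(ltW y0)//.
rewrite -[y in ln y]sqr_sqrtr ?(ltW y0)// lnXn//.
have : Num.sqrt y * (Num.sqrt y * - ln (Num.sqrt y)) < Num.sqrt y * 1.
  by rewrite ltr_pM2l// mulrC -ltr_pdivlMr// div1r.
lra.
Unshelve. all: by end_near. Qed.

Section MaxEntropyPlan.
Variables (R : realType) (d : nat) (muA muB : vertex d -> R).
Hypotheses (hA : is_distr muA) (hB : is_distr muB).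

Local Notation I := (vertex d * vertex d)%type.
Local Notation plan := (prod_topology (fun _ : I => R)).

Let coord_continuous (p : I) : continuous (fun t : plan => t p).
Proof. exact: (@proj_continuous I (fun _ => R) p). Qed.

Let sum_continuous (J : Type) (r : seq J) (P : pred J) (F : J -> plan -> R) :
  (forall j, continuous (F j)) ->
  continuous (fun t => \sum_(j <- r | P j) F j t).
Proof.
by move=> cF; apply: (@continuous_big R J +%R 0 P) => [x|j _];
  [exact: add_continuous|exact: cF].
Qed.

Let transports : set plan :=
  [set t | is_transport muA muB (fun a b => t (a, b))].

Let transport_le1 tau : is_transport muA muB tau -> forall a b, tau a b <= 1.
Proof.
move=> [t0 tA tB] a b; case: hA => A0 A1; rewrite -A1.
rewrite (bigD1 a)//= tA (bigD1 b)//= -addrA lerDl addr_ge0 ?sumr_ge0//.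
Qed.

(** The plans form a closed subset of the cube of functions with values in [[0, 1]], which is
    compact by Tychonoff. *)
Let compact_transports : compact transports.
Proof.
apply: (@subclosed_compact _ _
  [set t : plan | forall p, `[0%R, 1%R]%classic (t p)]).
- have -> : transports = (\bigcap_(p in setT) [set t : plan | 0 <= t p] `&`
     ((\bigcap_(a in setT) [set t : plan | \sum_b t (a, b) = muA a]) `&`
      \bigcap_(b in setT) [set t : plan | \sum_a t (a, b) = muB b]))%classic.
    apply/seteqP; split => t.
      move=> [t0 tA tB]; split; [|split].
      + by move=> [a b] _; exact: t0.
      + by move=> a _; rewrite /= tA.
      + by move=> b _; rewrite /= tB.
    move=> [t0 [tA tB]]; split.
    + by move=> a b; exact: (t0 (a, b)).
    + by move=> a; rewrite -(tA a).
    + by move=> b; rewrite -(tB b).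
  apply: closedI; last apply: closedI; apply: closed_bigI => p _.
  + apply: (preimage_closed (f := fun t : plan => t p)
      (D := [set x | 0 <= x]%classic)) => [t _|].
      exact: coord_continuous.
    exact: closed_ge.
  + apply: (preimage_closed (f := fun t : plan => \sum_b t (p, b))
      (D := [set x | x = muA p]%classic)) => [t _|].
      by apply: sum_continuous => b; exact: coord_continuous.
    exact: closed_eq.
  + apply: (preimage_closed (f := fun t : plan => \sum_b t (b, p))
      (D := [set x | x = muB p]%classic)) => [t _|].
      by apply: sum_continuous => b; exact: coord_continuous.
    exact: closed_eq.
- exact: (@tychonoff I (fun=> R) (fun=> `[0, 1]%classic)
    (fun=> @segment_compact R 0 1)).
- move=> t tT [a b]; rewrite /= in_itv/=; case: (tT) => t0 _ _.
  by apply/andP; split; [exact: (t0 a b)|exact: (transport_le1 tT a b)].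
Qed.

Let transports_neq0 : (transports !=set0)%classic.
Proof.
(* The product plan is a transportation. *)
case: hA hB => A0 A1 [B0 B1]; exists (fun p => muA p.1 * muB p.2); split => /=.
- by move=> a b; rewrite mulr_ge0.
- by move=> a; rewrite -mulr_sumr B1 mulr1.
- by move=> b; rewrite -mulr_suml A1 mul1r.
Qed.

Let cost (t : plan) := W2_cost (fun a b => t (a, b)).

Let cost_continuous : continuous cost.
Proof.
apply: sum_continuous => a; apply: sum_continuous => b t.
apply: (@continuous_comp plan R R (fun t => t (a, b))
  (fun x => x * (hdist a b)%:R ^+ 2)); first exact: coord_continuous.
exact: mulrr_continuous.
Qed.

(** Two successive extremal arguments: the continuous cost has a minimum on the compact set of
    plans, the minimizers again form a compact set, and the continuous entropy has a maximum
    there. *)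
Lemma max_entropy_optimal : exists2 tau, is_optimal muA muB tau &
  forall tau', is_optimal muA muB tau' ->
    entropy (fun p : I => tau' p.1 p.2) <= entropy (fun p : I => tau p.1 p.2).
Proof.
have [t0 /set_mem t0T t0min] := compact_EVT_min transports_neq0
  compact_transports (continuous_subspaceT cost_continuous).
have W2E : W2 muA muB = cost t0.
  apply/le_anti/andP; split.
    exact: W2_le_cost.
  apply: lb_le_inf; first by exists (cost t0), (fun a b => t0 (a, b)).
  move=> _ [tau tauT ->]; apply: (t0min (fun p => tau p.1 p.2)).
  by rewrite inE.
pose ent (t : plan) := entropy (fun p : I => t p).
have cent : continuous ent.
  apply: sum_continuous => p t.
  apply: (@continuous_comp plan R R (fun t => t p) (fun x => x * ln (1 / x))).
    exact: coord_continuous.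
  rewrite (_ : (fun x : R => _) = (fun x => - (x * ln x))); last first.
    by apply: funext => x; exact: mul_ln_inv.
  apply: (@continuous_comp R R R (fun x => x * ln x) -%R).
    exact: continuous_mul_ln.
  exact: opp_continuous.
pose optimal := (transports `&` [set t | cost t = cost t0])%classic.
have copt : compact optimal.
  apply: compact_closedI => //.
  apply: (preimage_closed (f := cost) (D := [set x | x = cost t0]%classic)) => [t _|].
    exact: cost_continuous.
  exact: closed_eq.
have opt0 : (optimal !=set0)%classic by exists t0.
have [t1 /set_mem[t1T t1c] t1max] := compact_EVT_max opt0 copt (continuous_subspaceT cent).
exists (fun a b => t1 (a, b)); first by split; rewrite // W2E.
move=> tau [tauT tauW].
have := t1max (fun p => tau p.1 p.2).
rewrite inE => /(_ _)/le_trans; apply; first by split; rewrite //= -W2E.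
by rewrite le_eqVlt; apply/orP; left; apply/eqP; apply: eq_bigr => -[].
Qed.

End MaxEntropyPlan.

(** * Entropy of a midpoint *)

(** This is [ln t <= t - 1] at [t = q x / p x], averaged over [p]. The mass of [q] is bounded on the
    support of [p] only, because [mean_pair_ge0] controls it only there. *)
Lemma gibbs_ge0 (R : realType) (T : finType) (p q : T -> R) :
  (forall x, 0 <= p x) -> (forall x, 0 < p x -> 0 < q x) ->
  \sum_(x | 0 < p x) q x <= \sum_x p x ->
  0 <= \sum_x p x * (ln (p x) - ln (q x)).
Proof.
move=> p0 q0 qp.
have pE (f : T -> R) : (forall x, p x = 0 -> f x = 0) ->
    \sum_x f x = \sum_(x | 0 < p x) f x.
  move=> f0; rewrite [RHS]big_mkcond; apply: eq_bigr => x _.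
  by case: ifPn => // px; apply: f0; apply/eqP; rewrite eq_le p0 andbT leNgt.
rewrite pE => [|x ->]; last by rewrite mul0r.
rewrite (pE p)// in qp; apply: le_trans (_ : \sum_(x | 0 < p x) (p x - q x) <= _).
  by rewrite sumrB subr_ge0.
apply: ler_sum => x px; have qx := q0 _ px.
have : ln (1 + (q x / p x - 1)) <= q x / p x - 1.
  by apply: le_ln1Dx; rewrite ltrBDl subrr divr_gt0.
rewrite addrCA subrr addr0 ln_div ?posrE// => h.
have : p x * (ln (q x) - ln (p x)) <= p x * (q x / p x - 1) by rewrite ler_pM2l.
by rewrite mulrBr mulrBr mulrBr mulrCA divff ?gt_eqF//; lra.
Qed.

Lemma sum_triple (R : nmodType) (V W M : finType) (F : V * W * M -> R) :
  \sum_x F x = \sum_a \sum_b \sum_m F (a, b, m).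
Proof.
rewrite pair_bigA /= pair_bigA /=.
by apply: eq_bigr => -[[a b] m].
Qed.

Section ThreeMidpoints.
Variable R : realType.

Section Marginals.
Variables (V W M : finType) (P : V -> W -> M -> R).
Hypothesis P0 : forall a b m, 0 <= P a b m.

Definition marginAB a b := \sum_m P a b m.
Definition marginA a := \sum_b marginAB a b.
Definition marginB b := \sum_a marginAB a b.
Definition marginAM a m := \sum_b P a b m.
Definition marginBM b m := \sum_a P a b m.
Definition marginM m := \sum_a marginAM a m.

(** All entropies are put in the form of means of logarithms, so that [mean_eq] reduces their linear
    relations to pointwise identities where [P] is positive. *)
Definition mean (f : V -> W -> M -> R) :=
  \sum_a \sum_b \sum_m P a b m * f a b m.

Lemma mean_eq f g : (forall a b m, 0 < P a b m -> f a b m = g a b m) ->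
  mean f = mean g.
Proof.
move=> fg; apply: eq_bigr => a _; apply: eq_bigr => b _; apply: eq_bigr => m _.
have := P0 a b m; rewrite le_eqVlt => /predU1P[<-|/fg ->//].
by rewrite !mul0r.
Qed.

Lemma meanD f g : mean f + mean g = mean (fun a b m => f a b m + g a b m).
Proof.
rewrite /mean -big_split; apply: eq_bigr => a _; rewrite -big_split.
apply: eq_bigr => b _; rewrite -big_split; apply: eq_bigr => m _.
by rewrite mulrDr.
Qed.

Lemma meanZ k f : k * mean f = mean (fun a b m => k * f a b m).
Proof.
rewrite /mean mulr_sumr; apply: eq_bigr => a _; rewrite mulr_sumr.
apply: eq_bigr => b _; rewrite mulr_sumr; apply: eq_bigr => m _.
by rewrite mulrCA.
Qed.

Lemma entropy_marginA : entropy marginA = mean (fun a _ _ => - ln (marginA a)).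
Proof.
rewrite entropyE; apply: eq_bigr => a _; rewrite /marginA mulr_suml.
by apply: eq_bigr => b _; rewrite mulr_suml.
Qed.

Lemma entropy_marginB : entropy marginB = mean (fun _ b _ => - ln (marginB b)).
Proof.
rewrite entropyE /mean exchange_big; apply: eq_bigr => b _.
by rewrite mulr_suml; apply: eq_bigr => a _; rewrite mulr_suml.
Qed.

Lemma mean_marginM (f : M -> R) :
  \sum_m marginM m * f m = mean (fun _ _ m => f m).
Proof.
under eq_bigr do rewrite mulr_suml.
rewrite exchange_big; apply: eq_bigr => a _.
under eq_bigr do rewrite mulr_suml.
by rewrite exchange_big.
Qed.

Lemma entropy_marginM : entropy marginM = mean (fun _ _ m => - ln (marginM m)).
Proof. by rewrite entropyE mean_marginM. Qed.

Lemma joint_le_marginals a b m : [/\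
  P a b m <= marginAB a b, P a b m <= marginAM a m,
  P a b m <= marginBM b m, P a b m <= marginA a & P a b m <= marginM m].
Proof.
have hAB : P a b m <= marginAB a b.
  by rewrite /marginAB (bigD1 m)//= lerDl sumr_ge0.
have hAM : P a b m <= marginAM a m.
  by rewrite /marginAM (bigD1 b)//= lerDl sumr_ge0.
split => //.
- by rewrite /marginBM (bigD1 a)//= lerDl sumr_ge0.
- apply: le_trans hAB _; rewrite /marginA (bigD1 b)//= lerDl sumr_ge0// => *.
  exact: sumr_ge0.
- apply: le_trans hAM _; rewrite /marginM (bigD1 a)//= lerDl sumr_ge0// => *.
  exact: sumr_ge0.
Qed.

Lemma mean_gibbs (q : V -> W -> M -> R) :
  (forall a b m, 0 < P a b m -> 0 < q a b m) ->
  \sum_a \sum_b \sum_(m | 0 < P a b m) q a b m <= \sum_a marginA a ->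
  0 <= mean (fun a b m => ln (P a b m) - ln (q a b m)).
Proof.
move=> q0 qP.
have := @gibbs_ge0 R _ (fun x : V * W * M => P x.1.1 x.1.2 x.2)
  (fun x => q x.1.1 x.1.2 x.2) (fun x => P0 _ _ _) (fun x => @q0 _ _ _).
rewrite [X in X <= _]big_mkcond !sum_triple /=; apply.
move: qP; congr (_ <= _); apply: eq_bigr => a _; apply: eq_bigr => b _.
by rewrite big_mkcond.
Qed.

(* Nonnegativity of [I(M; B | A)]. *)
Lemma mean_cond_ge0 : 0 <= mean (fun a b m =>
  ln (P a b m) - ln (marginAB a b) - ln (marginAM a m) + ln (marginA a)).
Proof.
have AB0 a b : 0 <= marginAB a b by exact: sumr_ge0.
have A0 a : 0 <= marginA a by exact: sumr_ge0.
have AM0 a m : 0 <= marginAM a m by exact: sumr_ge0.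
(* The comparison law makes B and M independent given A. *)
have := @mean_gibbs (fun a b m => marginAB a b * marginAM a m / marginA a).
rewrite (@mean_eq _ (fun a b m =>
    ln (P a b m) - ln (marginAB a b) - ln (marginAM a m) + ln (marginA a)));
  last first.
  move=> a b m Pabm; have [] := joint_le_marginals a b m.
  do ![move=> /(lt_le_trans Pabm) ?].
  by rewrite ln_div ?posrE ?mulr_gt0// lnM ?posrE//; lra.
apply.
  move=> a b m Pabm; have [] := joint_le_marginals a b m.
  by do ![move=> /(lt_le_trans Pabm) ?]; rewrite divr_gt0 ?mulr_gt0.
apply: ler_sum => a _.
apply: le_trans (_ : \sum_b \sum_m marginAB a b * marginAM a m / marginA a <= _).
  apply: ler_sum => b _; rewrite big_mkcond; apply: ler_sum => m _.
  by case: ifP => // _; rewrite divr_ge0 ?mulr_ge0.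
under eq_bigr do rewrite -mulr_suml -mulr_sumr.
have AME : \sum_m marginAM a m = marginA a by rewrite /marginAM exchange_big.
rewrite -mulr_suml -mulr_suml AME -/(marginA a).
by have [->|An0] := eqVneq (marginA a) 0; rewrite ?mul0r// mulfK.
Qed.

End Marginals.

Variables (V W M : finType) (P : V -> W -> M -> R) (phi : V -> W -> M -> M).
Hypothesis P0 : forall a b m, 0 <= P a b m.
Hypothesis P1 : \sum_a marginA P a = 1.
Hypothesis P_exchange : forall a b a' b' m,
  P a b m * P a' b' m = P a b' m * P a' b m.
Hypothesis phiK : forall a b, involutive (phi a b).
Hypothesis P_phi : forall a b m, P a b (phi a b m) = P a b m.
Hypothesis phi_inj : forall a b a' b' m, 0 < P a b m -> 0 < P a' b' m ->
  phi a b m = phi a' b' m -> (a, b) = (a', b').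

(** Sum [P_exchange] over all [a'] and [b']. *)
Let P_condindep a b m :
  P a b m * marginM P m = marginAM P a m * marginBM P b m.
Proof.
rewrite /marginAM /marginBM big_distrlr /= exchange_big /= mulr_sumr.
apply: eq_bigr => a' _; rewrite mulr_sumr; apply: eq_bigr => b' _.
exact: P_exchange.
Qed.

(* Given [m], the pair [(a, b)] is determined by [phi a b m], which is
   distributed as [m]; hence the entropy of [(a, b)] given [m] is at most the
   entropy of [m]. *)
Let mean_pair_ge0 :
  0 <= mean P (fun a b m => ln (P a b m) - ln (marginM P m) - ln (marginM P m)).
Proof.
have M0 m : 0 <= marginM P m by apply: sumr_ge0 => a _; exact: sumr_ge0.
have -> : mean P (fun a b m => ln (P a b m) - ln (marginM P m) - ln (marginM P m)) =
    mean P (fun a b m => ln (P a b m) -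
      ln (marginM P m * marginM P (phi a b m))).
  (* Since [phi a b] permutes the midpoints and preserves [P a b], one of the two terms
     [ln (marginM P m)] may be evaluated at [phi a b m] instead. *)
  have MphiE : mean P (fun _ _ m => ln (marginM P m)) =
      mean P (fun a b m => ln (marginM P (phi a b m))).
    apply: eq_bigr => a _; apply: eq_bigr => b _.
    rewrite (reindex_inj (inv_inj (phiK a b))); apply: eq_bigr => m _.
    by rewrite P_phi.
  have sum2 : mean P (fun a b m => ln (P a b m) - ln (marginM P m) - ln (marginM P m)) =
     mean P (fun a b m => ln (P a b m) - ln (marginM P m)) +
     -1 * mean P (fun _ _ m => ln (marginM P m)).
    rewrite meanZ meanD; apply: mean_eq => // a b m _; lra.
  rewrite sum2 MphiE meanZ meanD; apply: mean_eq => // a b m Pabm.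
  have [_ _ _ _ /(lt_le_trans Pabm) Mm] := joint_le_marginals P0 a b m.
  have Pphi : 0 < P a b (phi a b m) by rewrite P_phi.
  have [_ _ _ _ /(lt_le_trans Pphi) Mphi] := joint_le_marginals P0 a b (phi a b m).
  by rewrite lnM ?posrE//; lra.
apply: mean_gibbs => //.
  move=> a b m Pabm.
  have [_ _ _ _ /(lt_le_trans Pabm) Mm] := joint_le_marginals P0 a b m.
  have Pphi : 0 < P a b (phi a b m) by rewrite P_phi.
  have [_ _ _ _ /(lt_le_trans Pphi) Mphi] := joint_le_marginals P0 a b (phi a b m).
  exact: mulr_gt0.
have M1 : \sum_m marginM P m = 1.
  rewrite -P1 /marginM /marginA exchange_big; apply: eq_bigr => a _.
  by rewrite exchange_big.
rewrite P1.
apply: le_trans (_ : \sum_m marginM P m * 1 <= 1);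
  last by rewrite -mulr_suml M1 mulr1.
under eq_bigr => a _ do (under eq_bigr => b _ do rewrite big_mkcond;
  rewrite exchange_big).
rewrite exchange_big; apply: ler_sum => m _ /=.
rewrite pair_bigA -big_mkcond /= -mulr_sumr ler_wpM2l//.
(* For fixed [m], group the pairs by [m' = phi a b m]. By [phi_inj] each class contains at most one
   pair of the support, so the sum is at most the total mass of [marginM P]. *)
rewrite -M1 (partition_big (fun x => phi x.1 x.2 m) predT)//=.
apply: ler_sum => m' _.
case: (pickP (fun x : V * W => (0 < P x.1 x.2 m) && (phi x.1 x.2 m == m'))) => [x|none].
  move=> /andP[Px /eqP phix]; rewrite (big_pred1 x) ?phix// => y /=.
  apply/andP/eqP => [[Py /eqP phiy]|->]; last by rewrite Px phix.
  move: x y Px Py phix phiy => [a b] [a' b'] /= Px Py phix phiy.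
  by apply: (phi_inj Py Px); rewrite phix.
by rewrite big_pred0.
Qed.

(** Add [I(M; B | A) >= 0], [I(M; A | B) >= 0] and [mean_pair_ge0]. By [P_condindep] the logarithms
    of [marginAM] and [marginBM] sum to those of [P] and [marginM], which leaves only the terms of
    the statement. *)
Lemma three_midpoints :
  entropy (marginA P) + entropy (marginB P)
    + 2 * mean P (fun a b m => ln (marginAB P a b) - ln (P a b m))
  <= 3 * entropy (marginM P).
Proof.
have hA := mean_cond_ge0 P0.
have hB : 0 <= mean P (fun a b m =>
    ln (P a b m) - ln (marginAB P a b) - ln (marginBM P b m) + ln (marginB P b)).
  have := mean_cond_ge0 (P := fun b a m => P a b m) (fun b a m => P0 a b m).
  by rewrite /mean exchange_big.
rewrite entropy_marginA entropy_marginB entropy_marginM -subr_ge0.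
rewrite -[X in _ - X]opprK opprK -mulN1r !meanZ !meanD !meanZ !meanD.
have := addr_ge0 hA (addr_ge0 hB mean_pair_ge0).
rewrite !meanD; congr (_ <= _); apply: mean_eq => // a b m Pabm.
have [_ hAM hBM _ hM] := joint_le_marginals P0 a b m.
have : ln (P a b m * marginM P m) = ln (marginAM P a m * marginBM P b m).
  by rewrite P_condindep.
rewrite !lnM ?posrE ?(lt_le_trans Pabm)//; lra.
Qed.

End ThreeMidpoints.

(** * Maximality of the entropy *)

Section MassExchange.
Variables (R : realType) (I : finType).
Implicit Types (mu : I -> R) (p q s t : I) (e : R).

Definition exchange_mass mu p q s t e (x : I) : R :=
  mu x + e * ((x == s)%:R + (x == t)%:R - (x == p)%:R - (x == q)%:R).

Lemma sum_indicator (f : I -> R) s : \sum_x (x == s)%:R * f x = f s.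
Proof.
rewrite (bigD1 s)//= eqxx mul1r big1 ?addr0// => x /negPf->.
by rewrite mul0r.
Qed.

(** Convexity of [x * ln x]: its graph lies above the tangent at [y], also at the end point
    [x = 0]. *)
Lemma mul_ln_tangent (x y : R) : 0 <= x -> 0 < y ->
  (x - y) * (ln y + 1) <= x * ln x - y * ln y.
Proof.
rewrite le_eqVlt => /predU1P[<-|x0] y0; first by lra.
have : ln (1 + (y / x - 1)) <= y / x - 1.
  by apply: le_ln1Dx; rewrite ltrBDl subrr divr_gt0.
rewrite addrCA subrr addr0 ln_div ?posrE// -(ler_pM2l x0).
rewrite [X in _ <= X]mulrBr mulrCA divff ?gt_eqF//; lra.
Qed.

(** If [mu p * mu q] were the larger product, it would remain so after a small transfer of mass from
    [p], [q] to [s], [t], and by convexity this transfer would strictly increase the entropy. *)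
Lemma exchange_mass_le mu p q s t : (forall x, 0 <= mu x) ->
  uniq [:: p; q; s; t] -> 0 < mu p -> 0 < mu q ->
  (forall e, 0 < e -> e < mu p -> e < mu q ->
     entropy (exchange_mass mu p q s t e) <= entropy mu) ->
  mu p * mu q <= mu s * mu t.
Proof.
move=> mu0 /= /and4P[]; rewrite !inE !negb_or => /and3P[pq ps pt] /andP[qs qt] st _.
move=> p0 q0 max_mu; rewrite leNgt; apply/negP => lt_st.
have s0 := mu0 s; have t0 := mu0 t.
(* In [(mu p - e) * (mu q - e) - (mu s + e) * (mu t + e)] the squares of [e] cancel; [k] is half of
   the root of this affine function of [e]. *)
pose k := (mu p * mu q - mu s * mu t) / (2 * (mu p + mu q + mu s + mu t)).
have k0 : 0 < k by rewrite divr_gt0 ?subr_gt0 ?mulr_gt0//; lra.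
pose e := Num.min k (Num.min (mu p) (mu q) / 2).
have e0 : 0 < e by rewrite lt_min k0 divr_gt0// lt_min p0.
have [ep eq] : e < mu p /\ e < mu q.
  have : e <= Num.min (mu p) (mu q) / 2 by rewrite ge_min lexx orbT.
  have : Num.min (mu p) (mu q) <= mu p by rewrite ge_min lexx.
  have : Num.min (mu p) (mu q) <= mu q by rewrite ge_min lexx orbT.
  by split; lra.
have ek : e * (mu p + mu q + mu s + mu t) < mu p * mu q - mu s * mu t.
  have S0 : 0 < mu p + mu q + mu s + mu t by lra.
  apply: le_lt_trans (_ : k * (mu p + mu q + mu s + mu t) < _).
    by rewrite ler_pM2r// ge_min lexx.
  have -> : k * (mu p + mu q + mu s + mu t) = (mu p * mu q - mu s * mu t) / 2.
    by rewrite /k; field; rewrite gt_eqF//.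
  lra.
clearbody e; set mu' := exchange_mass mu p q s t e.
have neqs (x y : I) : x != y -> ((x == y) = false) * ((y == x) = false).
  by move=> xy; rewrite [y == x]eq_sym (negPf xy).
have neq := (neqs _ _ pq, neqs _ _ ps, neqs _ _ pt, neqs _ _ qs, neqs _ _ qt,
  neqs _ _ st).
have mu'p : mu' p = mu p - e by rewrite /mu' /exchange_mass eqxx !neq /=; lra.
have mu'q : mu' q = mu q - e by rewrite /mu' /exchange_mass eqxx !neq /=; lra.
have mu's : mu' s = mu s + e by rewrite /mu' /exchange_mass eqxx !neq /=; lra.
have mu't : mu' t = mu t + e by rewrite /mu' /exchange_mass eqxx !neq /=; lra.
(* The tangents are taken at the new masses, because [mu s] and [mu t] may vanish. *)
have gain : e * ((ln (mu' p) + 1) + (ln (mu' q) + 1)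
    - (ln (mu' s) + 1) - (ln (mu' t) + 1)) <= entropy mu' - entropy mu.
  rewrite -!(sum_indicator (fun x => ln (mu' x) + 1)) -big_split -!sumrB mulr_sumr.
  apply: ler_sum => x _; rewrite /= !mul_ln_inv opprK [X in _ <= X]addrC.
  have mu'x : mu' x = mu x + e * ((x == s)%:R + (x == t)%:R - (x == p)%:R - (x == q)%:R) by [].
  have [x0|x0] := ltP 0 (mu' x).
    have := mul_ln_tangent (mu0 x) x0; rewrite {1}mu'x; lra.
  have : [&& x != p, x != q, x != s & x != t].
    by apply/and4P; split; apply/eqP => xE; move: x0;
      rewrite xE ?mu'p ?mu'q ?mu's ?mu't /=; lra.
  move=> /and4P[/negPf xp /negPf xq /negPf xs /negPf xt].
  by rewrite mu'x xp xq xs xt !(addr0, subr0, mulr0, mul0r) subrr.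
have := max_mu e e0 ep eq; rewrite -/mu' -subr_le0 => /(le_trans gain).
rewrite pmulr_rle0// mu'p mu'q mu's mu't.
have [s'0 t'0] : 0 < mu s + e /\ 0 < mu t + e by split; lra.
have [p'0 q'0] : 0 < mu p - e /\ 0 < mu q - e by split; lra.
have : ln ((mu s + e) * (mu t + e)) < ln ((mu p - e) * (mu q - e)).
  by rewrite ltr_ln ?posrE ?mulr_gt0//; lra.
by rewrite !lnM ?posrE// => h1 h2; lra.
Qed.

End MassExchange.

(** * Midpoints in the hypercube *)

Lemma set2_eq (T : finType) (x y x' y' : T) : [set x; y] = [set x'; y'] ->
  (x = x' /\ y = y') \/ (x = y' /\ y = x').
Proof.
move=> /setP E.
have xP : (x == x') || (x == y') by have := E x; rewrite !inE eqxx => <-.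
have yP : (y == x') || (y == y') by have := E y; rewrite !inE eqxx orbT => <-.
have x'P : (x' == x) || (x' == y) by have := E x'; rewrite !inE eqxx => ->.
have y'P : (y' == x) || (y' == y) by have := E y'; rewrite !inE eqxx orbT => ->.
case/orP: xP => /eqP xE; [left|right]; split => //.
  by case/orP: yP => /eqP yE //; case/orP: y'P => /eqP ->; rewrite ?yE ?xE.
by case/orP: yP => /eqP yE //; case/orP: x'P => /eqP ->; rewrite ?yE ?xE.
Qed.

(** In [card_midpoints], the first set collects the coordinates flipped before the midpoint and the
    second one the coordinate of its edge, if any. *)
Lemma card_subset_pairs (T : finType) (D : {set T}) k l :
  #|[set p : {set T} * {set T} | [&& p.1 \subset D, #|p.1| == k,
     p.2 \subset D :\: p.1 & #|p.2| == l]]| = ('C(#|D|, k) * 'C(#|D| - k, l))%N.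
Proof.
rewrite -sum1dep_card.
rewrite (eq_bigl (fun p : {set T} * {set T} => ((p.1 \subset D) && (#|p.1| == k)) &&
  ((p.2 \subset D :\: p.1) && (#|p.2| == l)))); last by move=> p;
    rewrite -!andbA.
rewrite -(pair_big_dep (fun A : {set T} => (A \subset D) && (#|A| == k))
  (fun A (B : {set T}) => (B \subset D :\: A) && (#|B| == l)) (fun _ _ => 1%N)) /=.
rewrite (eq_bigr (fun=> 'C(#|D| - k, l)%N)); last first.
  move=> A /andP[AD /eqP Ak]; rewrite sum1dep_card cards_draws cardsD.
  by rewrite (finset.setIidPr AD) Ak.
by rewrite sum_nat_cond_const cards_draws.
Qed.

Section Geometry.
Variable d : nat.
Local Open Scope nat_scope.
Implicit Types (a b u v w z : vertex d) (m : vertex_or_edge d).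
Implicit Types (A B : {set 'I_d}).

Lemma hdistE u v : hdist u v = \sum_i (u i != v i).
Proof.
rewrite /hdist -sum1_card big_mkcond; apply: eq_bigr => i _.
by rewrite inE; case: ifP.
Qed.

Lemma hdistC u v : hdist u v = hdist v u.
Proof. by rewrite !hdistE; apply: eq_bigr => i _; rewrite eq_sym. Qed.

Lemma hdist_eq0 u v : hdist u v = 0 -> u = v.
Proof.
move=> /card0_eq uv; apply/ffunP => i.
by have := uv i; rewrite !inE => /negbFE/eqP.
Qed.

Lemma hdistxx u : hdist u u = 0.
Proof. by rewrite hdistE big1// => i _; rewrite eqxx. Qed.

(** A coordinate in which [u] differs from both ends is crossed there and back. *)
Lemma hdist_detour u a b :
  hdist a u + hdist u b = hdist a b + 2 * \sum_i ((u i != a i) && (u i != b i)).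
Proof.
rewrite !hdistE big_distrr -!big_split; apply: eq_bigr => i _ /=.
by case: (a i) (u i) (b i) => [] [] [].
Qed.

Lemma hdist_triangle u a b : hdist a b <= hdist a u + hdist u b.
Proof. by rewrite hdist_detour leq_addr. Qed.

Lemma hdist_between u a b : hdist a u + hdist u b <= hdist a b ->
  forall i, (u i == a i) || (u i == b i).
Proof.
rewrite hdist_detour -[X in _ <= X]addn0 leq_add2l leqn0 muln_eq0 /=.
rewrite sum_nat_eq0 => /forallP h i.
by have := h i; rewrite eqb0 negb_and !negbK.
Qed.

(** Viewing a midpoint as a set of one or two vertices treats both parities of the distance at
    once. *)
Definition midset m : {set vertex d} :=
  match m with inl u => [set u] | inr e => val e end.

Lemma edge_ends (e : edge d) : exists u v, hdist u v = 1 /\ val e = [set u; v].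
Proof. by case: e => e /= /existsP[u /existsP[v /andP[/eqP uv /eqP ->]]]; exists u, v. Qed.

Lemma edge_endsP (e : edge d) u v : val e = [set u; v] -> hdist u v = 1.
Proof.
by have [u' [v' [uv ->]]] := edge_ends e => /set2_eq[] [<- <-] //;
  rewrite hdistC.
Qed.

Lemma midset_inj : injective midset.
Proof.
move=> [u|e] [v|f] /=.
- by move=> /set1_inj ->.
- by rewrite -(finset.setUid [set u]) => /esym/edge_endsP; rewrite hdistxx.
- by rewrite -(finset.setUid [set v]) => /edge_endsP; rewrite hdistxx.
- by move=> /val_inj ->.
Qed.

Lemma midsetP u v : hdist u v <= 1 -> exists m, midset m = [set u; v].
Proof.
case duv : (hdist u v) => [|[|//]] _.
  by exists (inl u); rewrite -(hdist_eq0 duv) /= finset.setUid.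
have uv : is_edge [set u; v].
  by apply/existsP; exists u; apply/existsP; exists v; rewrite duv !eqxx.
by exists (inr (exist (fun e => is_edge e) _ uv)).
Qed.

(** Here [u] is the end near [a] and [v] the end near [b]; they coincide exactly when the distance
    is even. *)
Lemma midpointsP a b m : reflect
  (exists u v, [/\ midset m = [set u; v], hdist u v = odd (hdist a b),
     hdist a u = (hdist a b)./2 & hdist v b = (hdist a b)./2])
  (m \in midpoints a b).
Proof.
have DE := odd_double_half (hdist a b).
rewrite inE; case: m => [w|e] /=; apply: (iffP idP).
- move=> /and3P[Dev /eqP wa /eqP wb]; exists w, w.
  rewrite finset.setUid hdistxx (negPf Dev) (hdistC a w); split => //; lia.
- move=> [u [v [+ uv au vb]]]; rewrite -(finset.setUid [set w]) => /set2_eq wuv.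
  have [wu wv] : w = u /\ w = v by case: wuv => -[-> ->].
  move: uv au vb; rewrite -wu -wv hdistxx (hdistC a w) => /esym/eqP.
  rewrite eqb0 => Dev -> ->; rewrite Dev /=; move: DE; rewrite (negPf Dev); lia.
- move=> /andP[Dodd /existsP[u /existsP[v /and3P[/eqP uv /eqP ua /eqP vb]]]].
  exists u, v; rewrite (edge_endsP uv) Dodd (hdistC a u); split => //.
  + by move: DE; rewrite Dodd; lia.
  + by move: DE; rewrite Dodd; lia.
- move=> [u [v [uv duv au vb]]].
  have Dodd : odd (hdist a b) by move: duv; rewrite (edge_endsP uv); case: odd.
  rewrite Dodd; apply/existsP; exists u; apply/existsP; exists v.
  by rewrite uv eqxx hdistC au vb; move: DE; rewrite Dodd; lia.
Qed.

(* If two pairs of an optimal plan share a midpoint, the exchange inequality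
   forces all four distances to agree, and the two geodesics to cross the
   midpoint in the same direction. *)
Lemma midpoint_exchange a b a' b' m :
  m \in midpoints a b -> m \in midpoints a' b' ->
  hdist a b ^ 2 + hdist a' b' ^ 2 <= hdist a b' ^ 2 + hdist a' b ^ 2 ->
  exists u v, [/\ midset m = [set u; v],
    hdist u v = odd (hdist a b),
    hdist a u = (hdist a b)./2 /\ hdist a' u = (hdist a b)./2,
    hdist v b = (hdist a b)./2 /\ hdist v b' = (hdist a b)./2 &
    [/\ hdist a' b' = hdist a b, hdist a b' = hdist a b
      & hdist a' b = hdist a b]].
Proof.
move=> /midpointsP[u [v [muv duv au vb]]] /midpointsP[u' [v' [muv' duv' au' vb']]].
have DE := odd_double_half (hdist a b); have DE' := odd_double_half (hdist a' b').
have := muv'; rewrite muv => /set2_eq[[uu' vv']|[uv' vu']] cyc.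
  (* Same direction: with half-distances [r], [r'] and parity [o], both cross distances are at most
     [r + o + r']. The exchange inequality then forces [r = r'] and equality. *)
  subst u' v'.
  have oE : odd (hdist a b) = odd (hdist a' b') :> nat by lia.
  have tri1 := hdist_triangle u a b'; have tri1' := hdist_triangle v u b'.
  have tri2 := hdist_triangle u a' b; have tri2' := hdist_triangle v u b.
  have rr : (hdist a' b')./2 = (hdist a b)./2 by nia.
  rewrite rr in au' vb'; exists u, v; split => //.
  by split; nia.
(* Opposite directions: both cross distances are at most [r + r'], as the edge need not be crossed.
   This contradicts the exchange inequality for odd distances; for even ones [u = v]. *)
subst u' v'.
have tri1 := hdist_triangle u a b'; have tri2 := hdist_triangle v a' b.
have oE : odd (hdist a b) = odd (hdist a' b') :> nat by rewrite hdistC in duv';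
  lia.
case: (boolP (odd (hdist a b))) => Dodd.
  rewrite Dodd in DE oE; rewrite -oE in DE'.
  have [h1 h2] : hdist a b' <= (hdist a b)./2 + (hdist a' b')./2 /\
    hdist a' b <= (hdist a b)./2 + (hdist a' b')./2 by lia.
  have [rE rE'] : hdist a b = 2 * (hdist a b)./2 + 1 /\
    hdist a' b' = 2 * (hdist a' b')./2 + 1 by lia.
  exfalso; move: cyc; rewrite {}rE {}rE'; move: h1 h2.
  move: (_./2) (_./2) (hdist a b') (hdist a' b) => r r' x y.
  move=> h1 h2; have := (nat_Cauchy r r').1.
  have := leq_mul h1 h1; have := leq_mul h2 h2; rewrite -!mulnn; nia.
rewrite (negPf Dodd) in duv DE oE; rewrite -oE in DE'.
have uv := hdist_eq0 duv; subst v.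
have rr : (hdist a' b')./2 = (hdist a b)./2 by nia.
rewrite rr in au' vb'; exists u, u; split => //.
by split; nia.
Qed.

(** The antipodal map of the subcube spanned by [a] and [b]; coordinates in which they agree are
    kept. *)
Definition reflection a b z : vertex d := [ffun i => a i (+) b i (+) z i].

Lemma hdist_reflection a b z w :
  hdist (reflection a b z) (reflection a b w) = hdist z w.
Proof.
rewrite !hdistE; apply: eq_bigr => i _; rewrite !ffunE.
by case: (a i) (b i) (z i) (w i) => [] [] [] [].
Qed.

Lemma reflectionK a b : involutive (reflection a b).
Proof.
move=> z; apply/ffunP => i; rewrite !ffunE.
by case: (a i) (b i) (z i) => [] [] [].
Qed.

Lemma reflection_ends a b : (reflection a b a = b) * (reflection a b b = a).
Proof.
split; apply/ffunP => i; rewrite !ffunE; by case: (a i) (b i) => [] [].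
Qed.

Lemma imset2_reflection a b u v :
  reflection a b @: [set u; v] = [set reflection a b u; reflection a b v].
Proof. by rewrite imsetU !imset_set1. Qed.

(** [insubd] turns the image of an edge back into an edge; [midset_midflip] shows that this image
    always is one, the reflection being an isometry. *)
Definition midflip a b m : vertex_or_edge d :=
  match m with
  | inl u => inl (reflection a b u)
  | inr e => inr (insubd e (reflection a b @: val e))
  end.

Lemma midset_midflip a b m :
  midset (midflip a b m) = reflection a b @: midset m.
Proof.
case: m => [u|e] /=; first by rewrite imset_set1.
rewrite val_insubd; case: ifPn => // /negP[].
have [u [v [uv ->]]] := edge_ends e; rewrite imset2_reflection.
apply/existsP; exists (reflection a b u); apply/existsP;
  exists (reflection a b v).
by rewrite hdist_reflection uv !eqxx.
Qed.

Lemma midflipK a b : involutive (midflip a b).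
Proof.
move=> m; apply: midset_inj; rewrite !midset_midflip -imset_comp.
by rewrite (eq_imset _ (_ : _ =1 id)) ?imset_id// => z; exact: reflectionK.
Qed.

(** The reflection is an isometry exchanging [a] and [b], so it exchanges the roles of the near and
    far ends. *)
Lemma midflip_midpoints a b m :
  (midflip a b m \in midpoints a b) = (m \in midpoints a b).
Proof.
suff h m' : m' \in midpoints a b -> midflip a b m' \in midpoints a b.
  by apply/idP/idP => /h//; rewrite midflipK.
move=> /midpointsP[u [v [muv duv au vb]]]; apply/midpointsP.
exists (reflection a b v), (reflection a b u).
rewrite midset_midflip muv imset2_reflection finset.setUC hdist_reflection hdistC; split => //.
  by rewrite -{1}(reflection_ends a b).2 hdist_reflection hdistC.
by rewrite -{2}(reflection_ends a b).1 hdist_reflection hdistC.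
Qed.

(* The reflection of the midpoint gives [a + b]; since the four geodesics
   between [{a, a'}] and [{b, b'}] all cross the midpoint, the coordinates that
   change before the midpoint are disjoint from those that change after it, so
   that [a + b] determines [(a, b)]. *)
Lemma midflip_inj a b a' b' m :
  m \in midpoints a b -> m \in midpoints a' b' ->
  hdist a b ^ 2 + hdist a' b' ^ 2 <= hdist a b' ^ 2 + hdist a' b ^ 2 ->
  midflip a b m = midflip a' b' m -> (a, b) = (a', b').
Proof.
move=> mab mab' cyc.
have [u [v [muv duv [au a'u] [vb vb'] [D1 D2 D3]]]] := midpoint_exchange mab mab' cyc.
move=> /(congr1 midset); rewrite !midset_midflip muv !imset2_reflection => /set2_eq E.
have DE := odd_double_half (hdist a b).
have btw x y : hdist x u = (hdist a b)./2 -> hdist v y = (hdist a b)./2 ->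
    hdist x y = hdist a b -> forall i, ((u i == x i) || (u i == y i)) &&
    ((u i == v i) || (u i == x i) && (v i == y i)).
  move=> xu vy xy i.
  have t1 := hdist_triangle u x v; have t2 := hdist_triangle v u y.
  have t3 := hdist_triangle u x y; have t4 := hdist_triangle v x y.
  have /(_ i) b1 : forall i, (u i == x i) || (u i == y i) by apply: hdist_between; lia.
  have /(_ i) b2 : forall i, (u i == x i) || (u i == v i) by apply: hdist_between; lia.
  have /(_ i) b3 : forall i, (v i == u i) || (v i == y i) by apply: hdist_between; lia.
  by move: b1 b2 b3; case: (x i) (y i) (u i) (v i) => [] [] [] [].
have B1 := btw a b au vb erefl; have B2 := btw a' b' a'u vb' D1.
have B3 := btw a b' au vb' D2; have B4 := btw a' b a'u vb D3.
(* A crosswise matching of the ends is excluded on the coordinate of the edge: there both pairs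
   differ, so [a + b] and [a' + b'] agree. *)
have ru : reflection a b u = reflection a' b' u.
  case: E => [[->//]|[Eu _]]; apply/ffunP => i.
  move: (congr1 (fun f : vertex d => f i) Eu) (B1 i) (B2 i); rewrite !ffunE.
  by case: (a i) (b i) (a' i) (b' i) (u i) (v i) => [] [] [] [] [] [].
have [aE bE] : (forall i, a i = a' i) /\ (forall i, b i = b' i).
  split=> i; move: (congr1 (fun f : vertex d => f i) ru) (B1 i) (B2 i) (B3 i) (B4 i); rewrite !ffunE;
  by case: (a i) (b i) (a' i) (b' i) (u i) (v i) => [] [] [] [] [] [].
by congr (_, _); apply/ffunP.
Qed.

(** * Midpoints as pairs of coordinate sets *)

Definition flip a A : vertex d := [ffun i => a i (+) (i \in A)].
Definition diff a b : {set 'I_d} := [set i | a i != b i].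

Lemma flip_diff a b : flip a (diff a b) = b.
Proof. by apply/ffunP => i; rewrite !ffunE inE; case: (a i) (b i) => [] []. Qed.

Lemma diff_flip a A : diff a (flip a A) = A.
Proof. by apply/setP => i; rewrite !inE ffunE; case: (a i) (i \in A) => [] []. Qed.

Lemma card_diff a b : #|diff a b| = hdist a b.
Proof. by apply: eq_card => i; rewrite !inE. Qed.

(** Choose the [D./2] coordinates flipped before the midpoint and, for odd [D], the coordinate of
    the middle edge among the [uphalf D] remaining ones. For even [D] the second factor is 1. *)
Lemma card_midpoints a b : let D := hdist a b in
  #|midpoints a b| = 'C(D, D./2) * 'C(uphalf D, odd D).
Proof.
move=> D; set X := [set p : {set 'I_d} * {set 'I_d} | [&& p.1 \subset diff a b,
  #|p.1| == D./2, p.2 \subset diff a b :\: p.1 & #|p.2| == odd D]].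
pose g (p : {set 'I_d} * {set 'I_d}) := [set flip a p.1; flip a (p.1 :|: p.2)].
have DE := odd_double_half D.
have -> : uphalf D = #|diff a b| - D./2 by rewrite card_diff uphalf_half; lia.
have -> : 'C(D, D./2) = 'C(#|diff a b|, D./2) by rewrite card_diff.
rewrite -card_subset_pairs -/X.
rewrite -(card_imset _ midset_inj) -(card_in_imset (f := g)); last first.
  move=> [A B] [A' B']; rewrite !inE /= => /and4P[_ _ BA _] /and4P[_ _ BA' _].
  have {}BA i : (i \in B) ==> (i \notin A).
    by apply/implyP => /(fintype.subsetP BA); rewrite !inE => /andP[].
  have {}BA' i : (i \in B') ==> (i \notin A').
    by apply/implyP => /(fintype.subsetP BA'); rewrite !inE => /andP[].
  move=> /set2_eq[] [] /(congr1 (diff a)) + /(congr1 (diff a));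
    rewrite !diff_flip => /setP AA /setP AB;
  congr (_, _); apply/setP => i; move: (AA i) (AB i) (BA i) (BA' i);
    rewrite !inE;
  by case: (i \in A) (i \in B) (i \in A') (i \in B') => [] [] [] [].
congr #|pred_of_set _|; apply/setP => s; apply/imsetP/imsetP.
- move=> [m /midpointsP[u [v [-> duv au vb]]] ->].
  have t1 := hdist_triangle u a v; have t2 := hdist_triangle v u b.
  have t3 := hdist_triangle u a b; have t4 := hdist_triangle v a b.
  have b1 : forall i, (u i == a i) || (u i == b i) by apply: hdist_between; lia.
  have b2 : forall i, (u i == a i) || (u i == v i) by apply: hdist_between; lia.
  have b3 : forall i, (v i == u i) || (v i == b i) by apply: hdist_between; lia.
  exists (diff a u, diff u v); last first.
    congr [set _; _]; rewrite /= ?flip_diff//; apply/ffunP => i;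
      rewrite !ffunE !inE.
    by move: (b1 i) (b2 i) (b3 i); case: (a i) (b i) (u i) (v i) => [] [] [] [].
  rewrite inE /= !card_diff duv au !eqxx !andbT.
  apply/andP; split; apply/fintype.subsetP => i; rewrite !inE;
    move: (b1 i) (b2 i) (b3 i);
  by case: (a i) (b i) (u i) (v i) => [] [] [] [].
- move=> [[A B]]; rewrite inE /= => /and4P[AD /eqP Ak BD /eqP Bo] ->.
  have dB : hdist (flip a A) (flip a (A :|: B)) = #|B|.
    rewrite -card_diff; apply: eq_card => i; rewrite !inE !ffunE !inE.
    move/fintype.subsetP/(_ i): BD; rewrite !inE.
    by case: (a i) (i \in A) (i \in B) => [] [] [] // /(_ isT).
  have dv : hdist (flip a (A :|: B)) b = D - #|A| - #|B|.
    have -> : D - #|A| - #|B| = #|diff a b :\: A :\: B|.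
      by rewrite cardsD (finset.setIidPr BD) cardsD (finset.setIidPr AD) card_diff.
    rewrite -card_diff; apply: eq_card => i.
    have : (i \in A) ==> (a i != b i).
      by apply/implyP => /(fintype.subsetP AD); rewrite inE.
    have : (i \in B) ==> (a i != b i).
      by apply/implyP => /(fintype.subsetP BD); rewrite !inE => /andP[].
    rewrite !inE !ffunE !inE.
    by case: (a i) (b i) (i \in A) (i \in B) => [] [] [] [].
  have [|m mE] := midsetP (u := flip a A) (v := flip a (A :|: B)).
    by rewrite dB Bo; case: odd.
  exists m => //; apply/midpointsP; exists (flip a A), (flip a (A :|: B)).
  split; rewrite ?dB ?dv//; first by rewrite -card_diff diff_flip.
  by rewrite Ak Bo; move: DE; rewrite -/D; lia.
Qed.

End Geometry.

(** * Number of midpoints *)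

Section LnBinomial.
Variable R : realType.

(* [exp (1 / 20) <= 20 / 19] because [1 - x <= exp (- x)]. *)
Lemma ln_ge_twentieths k (x : R) : (20 / 19) ^+ k <= x -> k%:R / 20 <= ln x.
Proof.
move=> kx; have x0 : 0 < x by apply: lt_le_trans kx; apply: exprn_gt0; lra.
rewrite -ler_expR lnK ?posrE//; apply: le_trans kx.
rewrite expRM_natl lerXn2r ?nnegrE ?expR_ge0//; first by lra.
rewrite -[X in _ <= X]invrK -[expR _]invrK -expRN lef_pV2 ?posrE ?expR_gt0//;
  last by lra.
by apply: le_trans (expR_ge1Dx _); lra.
Qed.

Lemma central_binomial_rec r :
  (r.+1 * 'C(r.+1.*2, r.+1) = (4 * r + 2) * 'C(r.*2, r))%N.
Proof.
have /= e1 := mul_bin_diag r.*2.+2 r; have /= e2 := mul_bin_down r.*2.+1 r.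
have e3 : (r.*2.+1 - r = r.+1)%N by lia.
rewrite e3 in e2; rewrite doubleS -e1.
have -> : (r.*2.+2 = 2 * r.+1)%N by lia.
by rewrite -mulnA -e2; lia.
Qed.

(** The slope [6 / 5] lies below the asymptotic slope [ln 4], and the constant 1 leaves room for the
    first values. *)
Lemma ln_central_binomial_ge r :
  6 / 5 * r%:R - 1 <= ln ('C(r.*2, r)%:R : R).
Proof.
elim: r => [|r IH]; first by rewrite bin0 ln1; lra.
(* The ratio of consecutive terms exceeds [exp (6 / 5)] only from 3 on. *)
have [|r3] := ltnP r 3.
  (* The exponents 4, 28, 52 are 20 times the values 1/5, 7/5, 13/5 of the left-hand side. *)
  case: r IH => [|[|[|//]]] _ _.
  - by apply: le_trans (@ln_ge_twentieths 4 _ _);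
      [lra|rewrite (_ : 'C(_, _) = 2)//; lra].
  - by apply: le_trans (@ln_ge_twentieths 28 _ _);
      [lra|rewrite (_ : 'C(_, _) = 6)//; lra].
  - by apply: le_trans (@ln_ge_twentieths 52 _ _);
      [lra|rewrite (_ : 'C(_, _) = 20)//; lra].
have c0 : 0 < 'C(r.*2, r)%:R :> R by rewrite ltr0n bin_gt0 -addnn leq_addr.
(* The ratio [(4 * r + 2) / (r + 1)] increases with [r] and equals [7 / 2] at 3. *)
have step : 7 / 2 * 'C(r.*2, r)%:R <= 'C(r.+1.*2, r.+1)%:R :> R.
  have : (7 * 'C(r.*2, r) <= 2 * 'C(r.+1.*2, r.+1))%N.
    by rewrite -(leq_pmul2l (ltn0Sn r)); have := central_binomial_rec r; nia.
  by rewrite -(ler_nat R) !natrM; lra.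
have l72 : 6 / 5 <= ln (7 / 2) :> R.
  by apply: le_trans (@ln_ge_twentieths 24 _ _); lra.
apply: le_trans (_ : ln (7 / 2 * 'C(r.*2, r)%:R) <= _).
  by rewrite lnM ?posrE// -natr1; lra.
have s0 : 0 < 7 / 2 * 'C(r.*2, r)%:R :> R by apply: mulr_gt0 => //; lra.
by rewrite ler_ln ?posrE// (lt_le_trans s0).
Qed.

(** For [D = 2 * r + 1] the product is [(2 * r + 1) * 'C(2 * r, r)]; the extra factor, at least 3
    when [r > 0], pays for the additional [3 / 5]. *)
Lemma ln_binomial_midpoints_ge D :
  3 / 5 * D%:R - 1 <= ln (('C(D, D./2) * 'C(uphalf D, odd D))%:R : R).
Proof.
have [r ->] : exists r, D = (odd D + r.*2)%N by exists D./2;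
  rewrite odd_double_half.
have := ln_central_binomial_ge r.
rewrite oddD odd_double addbF oddb halfD odd_double andbF add0n doubleK uphalf_half.
rewrite oddD odd_double addbF oddb halfD odd_double andbF add0n doubleK.
case: (odd D) => /=; rewrite ?add0n; last first.
  by rewrite bin0 muln1 -muln2 natrM; lra.
rewrite !add1n bin1.
have /= := mul_bin_down r.*2.+1 r; have -> : (r.*2.+1 - r = r.+1)%N by lia.
rewrite [(r.+1 * _)%N]mulnC => <-.
have e2r : (r.*2.+1)%:R = 2 * r%:R + 1 :> R by rewrite -natr1 -muln2 natrM mulrC.
case: r e2r => [|r] e2r; first by rewrite bin0 muln1 ln1 e2r; lra.
have c0 : 0 < 'C(r.+1.*2, r.+1)%:R :> R by rewrite ltr0n bin_gt0 -addnn leq_addr.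
have n3 : 3 <= r.+1.*2.+1%:R :> R by rewrite ler_nat; lia.
have n0 : 0 < r.+1.*2.+1%:R :> R by rewrite ltr0n.
have : 3 / 5 <= ln (r.+1.*2.+1%:R) :> R.
  by apply: le_trans (@ln_ge_twentieths 12 _ _); lra.
by rewrite natrM lnM ?posrE// e2r; lra.
Qed.

End LnBinomial.

(** * Interpolation of an optimal plan *)

Section OptimalPlan.
Variables (R : realType) (d : nat) (muA muB : vertex d -> R).
Variable tau : vertex d -> vertex d -> R.
Hypothesis tau_optimal : is_optimal muA muB tau.

Local Notation tauP := (fun p : vertex d * vertex d => tau p.1 p.2).
Implicit Types (a b : vertex d).

Let tau0 a b : 0 <= tau a b. Proof. by case: tau_optimal => -[]. Qed.

Let swap a b a' b' e x y :=
  exchange_mass tauP (a, b) (a', b') (a, b') (a', b) e (x, y).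

(** Each row and each column gains as much as it loses. *)
Lemma swap_transport a b a' b' e : a != a' -> b != b' -> 0 <= e ->
  e <= tau a b -> e <= tau a' b' -> is_transport muA muB (swap a b a' b' e).
Proof.
move=> aa' bb' e0 eab eab'; have [[_ tA tB] _] := tau_optimal.
have sum1r (x y z : vertex d) : \sum_w ((x == y) && (w == z))%:R = (x == y)%:R :> R.
  case: eqP => _ /=; last by rewrite big1.
  by under eq_bigr do rewrite -[_%:R]mulr1; rewrite (sum_indicator (fun=> 1)).
split=> [x y|x|y].
- rewrite /swap /exchange_mass !xpair_eqE /=; move: (tau0 x y).
  have [->|xa] := eqVneq x a; have [->|yb] := eqVneq y b;
    rewrite ?(negPf aa') ?(negPf bb') ?andbF /= => txy; try lra.
  + by case: (y == b') => /=; lra.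
  + by case: (x == a') => /=; lra.
  + by move: txy; have [->|_] := eqVneq x a';
      have [->|_] := eqVneq y b' => /= ?; lra.
- rewrite /swap /exchange_mass big_split -mulr_sumr /= !sumrB big_split /=.
  under [X in X + _ - _ - _]eq_bigr do rewrite xpair_eqE.
  under [X in _ + X - _ - _]eq_bigr do rewrite xpair_eqE.
  under [X in _ + _ - X - _]eq_bigr do rewrite xpair_eqE.
  under [X in _ + _ - _ - X]eq_bigr do rewrite xpair_eqE.
  by rewrite !sum1r tA; lra.
- rewrite /swap /exchange_mass big_split -mulr_sumr /= !sumrB big_split /=.
  under [X in X + _ - _ - _]eq_bigr do rewrite xpair_eqE andbC.
  under [X in _ + X - _ - _]eq_bigr do rewrite xpair_eqE andbC.
  under [X in _ + _ - X - _]eq_bigr do rewrite xpair_eqE andbC.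
  under [X in _ + _ - _ - X]eq_bigr do rewrite xpair_eqE andbC.
  by rewrite !sum1r tB; lra.
Qed.

Lemma swap_cost a b a' b' e : W2_cost (swap a b a' b' e) = W2_cost tau +
  e * ((hdist a b')%:R ^+ 2 + (hdist a' b)%:R ^+ 2
       - (hdist a b)%:R ^+ 2 - (hdist a' b')%:R ^+ 2).
Proof.
rewrite /W2_cost !pair_bigA /= /swap /exchange_mass.
pose f (p : vertex d * vertex d) : R := (hdist p.1 p.2)%:R ^+ 2.
have fE x y : (hdist x y)%:R ^+ 2 = \sum_p (p == (x, y))%:R * f p.
  by rewrite sum_indicator.
rewrite (fE a b') (fE a' b) (fE a b) (fE a' b').
rewrite -big_split -!sumrB mulr_sumr -big_split; apply: eq_bigr => -[x y] _ /=.
by rewrite /f /=; lra.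
Qed.

(** Cyclical monotonicity for two pairs: otherwise swapping the partners of the smaller of the two
    masses would lower the cost. *)
Lemma optimal_exchange a b a' b' : 0 < tau a b -> 0 < tau a' b' ->
  (hdist a b ^ 2 + hdist a' b' ^ 2 <= hdist a b' ^ 2 + hdist a' b ^ 2)%N.
Proof.
move=> ab ab'.
have [->|aa'] := eqVneq a a'; first by rewrite addnC.
have [->|bb'] := eqVneq b b'; first by [].
pose e := Num.min (tau a b) (tau a' b').
have e0 : 0 < e by rewrite lt_min ab.
have [eab eab'] : e <= tau a b /\ e <= tau a' b' by rewrite !ge_min !lexx orbT.
have := W2_le_cost (swap_transport aa' bb' (ltW e0) eab eab').
rewrite swap_cost; case: tau_optimal => _ ->; rewrite lerDl pmulr_rge0//.
by rewrite -!natrX -(ler_nat R) !natrD; lra.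
Qed.

Hypothesis tau_max_entropy : forall tau', is_optimal muA muB tau' ->
  entropy (fun p : vertex d * vertex d => tau' p.1 p.2) <= entropy tauP.

(** The four distances agree, so swapping partners keeps the plan optimal, and [exchange_mass_le]
    applies. *)
Lemma max_entropy_exchange a b a' b' m : 0 < tau a b -> 0 < tau a' b' ->
  m \in midpoints a b -> m \in midpoints a' b' ->
  tau a b * tau a' b' <= tau a b' * tau a' b.
Proof.
move=> ab ab' mab mab'.
have [_ [_ [_ _ _ _ [D1 D2 D3]]]] :=
  midpoint_exchange mab mab' (optimal_exchange ab ab').
have [->|aa'] := eqVneq a a'; first by rewrite mulrC.
have [->|bb'] := eqVneq b b'; first by [].
apply: (@exchange_mass_le _ _ tauP (a, b) (a', b') (a, b') (a', b)) => //=.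
- by rewrite !inE !xpair_eqE !eqxx !(eq_sym a') !(eq_sym b') (negPf aa') (negPf bb').
- move=> e e0 eab eab'.
  rewrite -(@eq_entropy _ _ (fun p => swap a b a' b' e p.1 p.2)); last by case.
  apply: tau_max_entropy; split; first by apply: swap_transport; rewrite ?ltW.
  by rewrite swap_cost D1 D2 D3; case: tau_optimal => _ ->; lra.
Qed.

Let P a b m : R :=
  if m \in midpoints a b then tau a b / #|midpoints a b|%:R else 0.

Lemma card_midpoints_gt0 a b : 0 < #|midpoints a b|%:R :> R.
Proof.
rewrite ltr0n card_midpoints muln_gt0 !bin_gt0 uphalf_half leq_addr andbT.
by have := odd_double_half (hdist a b); lia.
Qed.

Let P0 a b m : 0 <= P a b m.
Proof. by rewrite /P; case: ifP => // _; rewrite divr_ge0// ltW// card_midpoints_gt0. Qed.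

Let P_gt0 a b m : (0 < P a b m) = (m \in midpoints a b) && (0 < tau a b).
Proof.
rewrite /P; case: ifP => _; last by rewrite ltxx.
by rewrite pmulr_lgt0 ?invr_gt0 ?card_midpoints_gt0.
Qed.

(** When the left side is positive, [m] is a midpoint of all four pairs, which have equally many
    midpoints. Exchanging [b] and [b'] gives the reverse inequality. *)
Let P_exchange_le a b a' b' m : P a b m * P a' b' m <= P a b' m * P a' b m.
Proof.
have := P0 a b m; rewrite le_eqVlt => /predU1P[<-|];
  first by rewrite mul0r mulr_ge0.
have := P0 a' b' m; rewrite le_eqVlt => /predU1P[<-|];
  first by rewrite mulr0 mulr_ge0.
rewrite !P_gt0 => /andP[mab' ab'] /andP[mab ab].
have [u [v [muv duv [au a'u] [vb vb'] [D1 D2 D3]]]] :=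
  midpoint_exchange mab mab' (optimal_exchange ab ab').
have m1 : m \in midpoints a b' by apply/midpointsP; exists u, v; rewrite D2.
have m2 : m \in midpoints a' b by apply/midpointsP; exists u, v; rewrite D3.
rewrite /P mab mab' m1 m2 !card_midpoints D1 D2 D3 -!card_midpoints.
rewrite mulrACA [X in _ <= X]mulrACA ler_wpM2r ?(max_entropy_exchange _ _ mab mab')//.
by rewrite mulr_ge0// invr_ge0 ltW// card_midpoints_gt0.
Qed.

Let marginAB_P a b : marginAB P a b = tau a b.
Proof.
rewrite /marginAB /P -big_mkcond sumr_const -[LHS]mulr_natr divfK//.
by rewrite gt_eqF// card_midpoints_gt0.
Qed.

Let marginA_P : marginA P =1 muA.
Proof.
move=> a; case: tau_optimal => -[_ -> _] _.
by apply: eq_bigr => b _; exact: marginAB_P.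
Qed.

Let marginB_P : marginB P =1 muB.
Proof.
move=> b; case: tau_optimal => -[_ _ ->] _.
by apply: eq_bigr => a _; exact: marginAB_P.
Qed.

Let marginM_P : marginM P =1 interpolation tau.
Proof. by move=> m; apply: eq_bigr => a _; rewrite [RHS]big_mkcond. Qed.

Hypothesis muA1 : \sum_a muA a = 1.

Let sum_tau : \sum_a \sum_b tau a b = 1.
Proof. by rewrite -muA1; apply: eq_bigr => a _; case: tau_optimal => -[_ -> _]. Qed.

Lemma interpolation_distr : is_distr (interpolation tau).
Proof.
split=> [m|].
  by rewrite -marginM_P; apply: sumr_ge0 => a _; apply: sumr_ge0 => b _.
under eq_bigr do rewrite -marginM_P; rewrite exchange_big -sum_tau.
apply: eq_bigr => a _; rewrite exchange_big.
by apply: eq_bigr => b _; exact: marginAB_P.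
Qed.

Lemma interpolation_support m :
  m \notin distr_midpoints muA muB -> interpolation tau m = 0.
Proof.
move=> mAB; apply: big1 => a _; apply: big1 => b mab.
have [->|tn0] := eqVneq (tau a b) 0; first by rewrite mul0r.
move: mAB; rewrite inE => /negP[]; apply/existsP; exists a; apply/existsP;
  exists b.
have tp : 0 < tau a b by rewrite lt0r tn0 tau0.
have [[_ tA tB] _] := tau_optimal.
rewrite mab tA tB andbT; apply/andP; split; rewrite gt_eqF//;
  apply: lt_le_trans tp _.
- by rewrite (bigD1 b)//= lerDl sumr_ge0.
- by rewrite (bigD1 a)//= lerDl sumr_ge0.
Qed.

Let mean_hdist : R := \sum_a \sum_b tau a b * (hdist a b)%:R.

(** Since distances are at most [d], both [W2 <= d * mean_hdist] and [mean_hdist <= d] hold. *)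
Let W2_le_mean_hdist : (0 < d)%N -> W2 muA muB ^+ 2 <= d%:R ^+ 3 * mean_hdist.
Proof.
move=> d0.
have dR : 0 < d%:R :> R by rewrite ltr0n.
have hd a b : (hdist a b)%:R <= d%:R :> R.
  by rewrite ler_nat -[X in (_ <= X)%N]card_ord max_card.
have h0 : 0 <= mean_hdist by apply: sumr_ge0 => a _; apply: sumr_ge0 => b _;
  rewrite mulr_ge0.
have hle : mean_hdist <= d%:R.
  have -> : d%:R = (\sum_a \sum_b tau a b) * d%:R by rewrite sum_tau mul1r.
  rewrite mulr_suml; apply: ler_sum => a _.
  by rewrite mulr_suml; apply: ler_sum => b _; rewrite ler_wpM2l.
have w0 : 0 <= W2 muA muB.
  case: tau_optimal => _ <-; apply: sumr_ge0 => a _; apply: sumr_ge0 => b _.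
  by rewrite mulr_ge0// sqr_ge0.
have wle : W2 muA muB <= d%:R * mean_hdist.
  case: tau_optimal => _ <-; rewrite mulr_sumr; apply: ler_sum => a _.
  rewrite mulr_sumr; apply: ler_sum => b _.
  by rewrite [leRHS]mulrCA expr2 ler_wpM2l// ler_wpM2r.
apply: le_trans (_ : (d%:R * mean_hdist) ^+ 2 <= _).
  by rewrite lerXn2r ?nnegrE// mulr_ge0// ltW.
have -> : d%:R ^+ 3 * mean_hdist = d%:R ^+ 2 * (d%:R * mean_hdist).
  by rewrite mulrA -exprSr.
by rewrite exprMn ler_wpM2l ?sqr_ge0// expr2 ler_wpM2r.
Qed.

Lemma interpolation_entropy : (0 < d)%N ->
  1 / 3 * entropy muA + 1 / 3 * entropy muB
    + 2 / (5 * d%:R ^+ 3) * (W2 muA muB) ^+ 2 - 2 / 3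
  <= entropy (interpolation tau).
Proof.
move=> d0.
have P1 : \sum_a marginA P a = 1.
  by rewrite -muA1; apply: eq_bigr => a _; exact: marginA_P.
have P_exchange a b a' b' m : P a b m * P a' b' m = P a b' m * P a' b m.
  by apply/le_anti; rewrite !P_exchange_le.
have P_flip a b m : P a b (midflip a b m) = P a b m by rewrite /P midflip_midpoints.
have flip_inj a b a' b' m : 0 < P a b m -> 0 < P a' b' m ->
    midflip a b m = midflip a' b' m -> (a, b) = (a', b').
  rewrite !P_gt0 => /andP[mab ab] /andP[mab' ab'].
  exact: midflip_inj mab mab' (optimal_exchange ab ab').
have := three_midpoints P0 P1 P_exchange (@midflipK d) P_flip flip_inj.
rewrite (eq_entropy marginA_P) (eq_entropy marginB_P) (eq_entropy marginM_P).
(* Given [(a, b)] the midpoint is uniform, so the right side is the mean of [ln #|midpoints a b|].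
   Its weight [2 / 3] in the final inequality produces [2 / 5] and [2 / 3]. *)
have : 3 / 5 * mean_hdist - 1 <=
    mean P (fun a b m => ln (marginAB P a b) - ln (P a b m)).
  rewrite (mean_eq P0 (g := fun a b _ => ln #|midpoints a b|%:R)); last first.
    move=> a b m; rewrite P_gt0 marginAB_P => /andP[mab ab].
    by rewrite /P mab ln_div ?posrE ?card_midpoints_gt0//; lra.
  rewrite /mean_hdist -[X in _ - X]sum_tau mulr_sumr -sumrB;
    apply: ler_sum => a _.
  rewrite mulr_sumr -sumrB; apply: ler_sum => b _.
  rewrite -mulr_suml -/(marginAB P a b) marginAB_P.
  have := ler_wpM2l (tau0 a b) (ln_binomial_midpoints_ge R (hdist a b)).
  by rewrite -card_midpoints; lra.
have : 2 / (5 * d%:R ^+ 3) * W2 muA muB ^+ 2 <= 2 / 5 * mean_hdist.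
  have d3 : 0 < d%:R ^+ 3 :> R by rewrite exprn_gt0// ltr0n.
  have -> : 2 / (5 * d%:R ^+ 3) * W2 muA muB ^+ 2 = 2 / 5 * (W2 muA muB ^+ 2 / d%:R ^+ 3).
    by field; rewrite gt_eqF// ltr0n.
  rewrite ler_pM2l; last by lra.
  by rewrite ler_pdivrMr// mulrC W2_le_mean_hdist.
lra.
Qed.

End OptimalPlan.

Theorem theorem3p18 (R : realType) (d : nat) (hd : (1 <= d)%N)
  (muA muB : vertex d -> R) (hA : is_distr muA) (hB : is_distr muB) :
  exists tau : vertex d -> vertex d -> R,
    [/\ is_optimal muA muB tau,
        is_distr (interpolation tau),
        (forall m, m \notin distr_midpoints muA muB -> interpolation tau m = 0)
      & 1 / 3 * entropy muA + 1 / 3 * entropy muB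
          + 2 / (5 * d%:R ^+ 3) * (W2 muA muB) ^+ 2 - 2 / 3
        <= entropy (interpolation tau)].
Proof.
have [tau tau_opt tau_max] := max_entropy_optimal hA hB.
have [_ muA1] := hA; exists tau; split => //.
- exact: interpolation_distr tau_opt muA1.
- exact: interpolation_support tau_opt.
- exact: interpolation_entropy tau_opt tau_max muA1 hd.
Qed.
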